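(* Let $q=3^k$ with $k>1$ a fixed integer, and let $$C_k:=\inf_{x\ge1}\left\{1+x^{-4k/3}\bigl((1+x+x^2)^k-1\bigr)\right\}.$$ Then, as $n\to\infty$, $$\operatorname{EGZ}(3,\mathbb{F}_q^n,2)\le C_k^{\,n+o(n)},\qquad C_k<q.$$ In particular, $$\operatorname{EGZ}(3,\mathbb{F}_{3^k}^n,2)\le\bigl(1+\gamma^k-x_0^{-4k/3}\bigr)^{n+o(n)},$$ where $x_0=\frac{1+\sqrt{33}}4$ and $\gamma=(1+x_0+x_0^2)x_0^{-4/3}$.
   Context: The elementary symmetric polynomial $e_2(x,y,z)=xy+yz+zx$ is applied coordinatewise to vectors of $\mathbb{F}_q^n$. $\operatorname{EGZ}(3,\mathbb{F}_q^n,2)$ is the least integer $\ell$ such that every sequence of length at least $\ell$ of elements of $\mathbb{F}_q^n$ (repetitions allowed) contains a subsequence of length $3$ (three terms with distinct indices) on which $e_2$ vanishes in every coordinate. The infimum is over real $x\ge1$. *)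

(* Defs.v *)
From HB Require Import structures.
From mathcomp Require Import all_boot all_order all_algebra all_field.
From mathcomp Require Import all_classical all_reals all_analysis.
Set Implicit Arguments.
Unset Strict Implicit.
Unset Printing Implicit Defensive.
Import Order.TTheory GRing.Theory Num.Theory.
Import numFieldNormedType.Exports.
Local Open Scope classical_set_scope.
Local Open Scope ring_scope.

Definition e2 (A : comNzRingType) (x y z : A) : A := x * y + y * z + z * x.

(* [subseq] selects positions, so x, y, z have distinct indices in s but may
   coincide as vectors. *)
Definition has_e2_zero (F : finFieldType) (n : nat) (s : seq 'rV[F]_n) : Prop :=
  exists x y z : 'rV[F]_n,
    subseq [:: x; y; z] s /\ forall i, e2 (x 0 i) (y 0 i) (z 0 i) = 0.

Definition EGZ_bound (F : finFieldType) (n l : nat) : Prop :=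
  forall s : seq 'rV[F]_n, (l <= size s)%N -> has_e2_zero s.

(* In characteristic 3, e2(x, x, x) = 3x^2 = 0, so by pigeonhole some bound
   exists and the least one is well defined. *)
Lemma EGZ_bound_ex (F : finFieldType) (k : nat) (hF : #|F| = (3 ^ k)%N)
  (n : nat) : exists l, `[< EGZ_bound F n l >].
Proof.
exists (2 * #|'rV[F]_n|).+1; apply/asboolP => s hs.
have char3 : (3 : F) = 0 by have /andP[_ /eqP] := card_finPcharP hF isT.
have [x hx] : exists x, (2 < count_mem x s)%N.
  apply/existsP; apply: contraLR hs; rewrite negb_exists => /forallP hc.
  have -> : size s = (\sum_x count_mem x s)%N.
    elim: s {hc} => [|a s IH] /=; first by rewrite big1.
    rewrite big_split /= -IH (bigD1 a) //= eqxx big1 ?addn0 // => i.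
    by rewrite eq_sym => /negPf ->.
  rewrite -leqNgt mulnC -sum_nat_const; apply: leq_sum => x _.
  by rewrite leqNgt.
exists x, x, x; split.
  apply: subseq_trans (filter_subseq (pred1 x) s).
  have /all_pred1P -> := filter_all (pred1 x) s.
  by rewrite size_filter; case: count hx => [|[|[|c]]] //= _; rewrite !eqxx sub0seq.
by move=> i; rewrite /e2 -mulr2n -mulrSr -mulr_natl char3 mul0r.
Qed.

(* EGZ hF n is EGZ(3, F^n, 2). *)
Definition EGZ (F : finFieldType) (k : nat) (hF : #|F| = (3 ^ k)%N)
  (n : nat) : nat := ex_minn (EGZ_bound_ex hF n).

Definition C_ (R : realType) (k : nat) : R :=
  inf [set 1 + x `^ (- (4 * k%:R / 3)) * ((1 + x + x ^+ 2) ^+ k - 1)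
      | x in [set x : R | 1 <= x]].

Definition x0 (R : realType) : R := (1 + Num.sqrt 33) / 4.

Definition gamma (R : realType) : R :=
  (1 + x0 R + x0 R ^+ 2) * x0 R `^ (- (4 / 3)).

(* E(n) <= c^(n + o(n)) as n -> oo. *)
Definition le_exp_no (R : realType) (E : nat -> nat) (c : R) : Prop :=
  exists2 o : nat -> R, o =o_\oo (fun n => n%:R : R)
    & \forall n \near \oo, (E n)%:R <= c `^ (n%:R + o n).

(* Main.v *)
Require Import Defs.
From mathcomp Require Import all_boot all_order all_algebra all_field.
From mathcomp Require Import all_classical all_reals all_analysis.
From mathcomp Require Import ring lra zify.
Import Order.TTheory GRing.Theory Num.Theory.
Import numFieldNormedType.Exports.
Local Open Scope ring_scope.
Set Implicit Arguments.
Unset Strict Implicit.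
Unset Printing Implicit Defensive.

(** The proof is a slice rank argument.  On nonzero elements
    [e2 x y z = x y z (1/x + 1/y + 1/z)], so [e2 x y z = 0] says that the
    inverses sum to zero, while if some argument is zero it says that at least
    two of them are.  With [u, v, w] the inverses, the indicator of [e2 = 0] is
    therefore [1 - (u + v + w)^(q-1)] on triples of nonzero elements, plus four
    products of indicators of [x = 0] and [x <> 0] ([e2_indicator]).

    As [q - 1] has all its base 3 digits equal to 2, the Frobenius map turns
    [(u + v + w)^(q-1)] into the product over [l < k] of the squares of
    [u_l + v_l + w_l] with [u_l = u^(3^l)], so that it is a combination of
    products of monomials in the [u_l], the [v_l] and the [w_l], with individual
    exponents at most 2 and total degree [2k].  On nonzero elements the top
    monomial [u^(q-1)] is the constant 1; its place in the family of [3^k]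
    monomials is thus free for the indicator of [x = 0], which is given the
    degree [2k/3], the most that the product of three of them allows.  Degrees
    are multiplied by 3 throughout to stay integral: one coordinate has weight at
    most [6k] ([e2_weight_le]), [n] coordinates at most [6kn] by multiplying
    out ([e2_vanish_weight_le]), and in each product one of the three factors has
    weight at most [2kn].

    If the indicator is diagonal on a set [A], then [A] has at most three times
    as many elements as there are such light factors ([weight_le_diagonal]), and
    an exponential moment bounds their number by [growth k x ^ n] for every
    [x >= 1] ([card_weight_le], [sum_basis_weight]).

    The terms of a sequence without a zero of [e2] need not form such a set,
    because [e2 x x y = x (x - y)] in characteristic 3, which vanishes in every
    coordinate when [x] is [y] with some coordinates replaced by zero.  Two
    distinct vectors so related have supports of different sizes, so the
    indicator is diagonal on each of the [n + 1] classes of given support size.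
    No vector occurs three times, whence
    [EGZ <= 6 (n + 1) C_k ^ n + 1] ([EGZ_le_C]); the polynomial factor and the
    added 1 go into the [o(n)].  Finally [C_k < 3^k] is seen at [x = (6/5)^3],
    and the explicit bound is the value at [x0]. *)

(** * Slice rank *)

(** The kernel of [M] has dimension [r >= m - s]; a basis of it contains an
    invertible square block of size [r], by which one can normalise the
    coordinates in the columns of that block to be all 1. *)
Lemma kernel_large_support (F : fieldType) (m s : nat) (M : 'M[F]_(m, s)) :
  exists (r : nat) (h : 'I_r -> 'I_m) (v : 'rV[F]_m),
    [/\ (m <= s + r)%N, v *m M = 0, injective h & forall i, v 0 (h i) = 1].
Proof.
have full : row_full (row_base (kermx M))^T.
  by rewrite -col_leq_rank mxrank_tr eq_row_base.
set h := fullrankfun full.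
pose G := colsub h (row_base (kermx M)).
have uG : G \in unitmx.
  rewrite -unitmx_tr -row_free_unit /G trmx_mxsub.
  exact: (fullrowsub_free full).
exists (\rank (kermx M)), h.
exists (const_mx 1 *m invmx G *m row_base (kermx M)); split.
- by rewrite mxrank_ker -leq_subLR leq_sub2l // rank_leq_col.
- apply/sub_kermxP; apply: submx_trans (submxMl _ _) _.
  by rewrite eq_row_base.
- exact: fullrankfun_inj.
- move=> i; have := congr1 (fun N : 'rV_ _ => N 0 i) (mulmxKV uG (const_mx 1 : 'rV_ _)).
  by rewrite /G mulmx_colsub !mxE => ->.
Qed.

(** The slice rank of a diagonal tensor is its size.  Contracting the first
    variable with a vector [v] orthogonal to all [f1 a] kills the first sum and
    leaves, on the left, the diagonal matrix of [v], whose rank is the size of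
    the support of [v]; on the right, a matrix of rank at most [s2 + s3]. *)
Lemma slice_rank_diagonal (F : fieldType) (m s1 s2 s3 : nat)
    (f1 : 'I_s1 -> 'I_m -> F) (g1 : 'I_s1 -> 'I_m -> 'I_m -> F)
    (f2 : 'I_s2 -> 'I_m -> F) (g2 : 'I_s2 -> 'I_m -> 'I_m -> F)
    (f3 : 'I_s3 -> 'I_m -> F) (g3 : 'I_s3 -> 'I_m -> 'I_m -> F) :
  (forall x y z, ((x == y) && (y == z))%:R =
    \sum_a f1 a x * g1 a y z + \sum_a f2 a y * g2 a x z
      + \sum_a f3 a z * g3 a x y) ->
  (m <= s1 + s2 + s3)%N.
Proof.
move=> E.
pose P1 := \matrix_(x < m, a < s1) f1 a x.
have [r [h [v [le_m vP1 h_inj v1]]]] := kernel_large_support P1.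
pose P2 := \matrix_(y < m, a < s2) f2 a y.
pose Q2 := \matrix_(a < s2, z < m) \sum_x v 0 x * g2 a x z.
pose P3 := \matrix_(y < m, a < s3) \sum_x v 0 x * g3 a x y.
pose Q3 := \matrix_(a < s3, z < m) f3 a z.
(* Contract the identity with [v] in the variable [x]. *)
have D : diag_mx v = P2 *m Q2 + P3 *m Q3.
  apply/matrixP => y z; rewrite !mxE.
  transitivity (\sum_x v 0 x * ((x == y) && (y == z))%:R).
    rewrite (bigD1 y) //= eqxx big1 ?addr0 ?mulr_natr // => x /negPf ->.
    by rewrite mulr0.
  under eq_bigr => x _ do rewrite E !mulrDr !mulr_sumr.
  rewrite !big_split /= exchange_big /= big1 ?add0r => [|a _].
    congr (_ + _); rewrite exchange_big; apply: eq_bigr => a _; rewrite !mxE.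
      by rewrite mulr_sumr; apply: eq_bigr => x _; rewrite mulrCA.
    by rewrite mulr_suml; apply: eq_bigr => x _; rewrite mulrCA mulrC.
  under eq_bigr => x _ do rewrite mulrA.
  rewrite -mulr_suml; have /matrixP/(_ 0 a) := vP1; rewrite !mxE.
  by under eq_bigr => x _ do rewrite mxE; move=> ->; rewrite mul0r.
have le_r : (r <= \rank (diag_mx v))%N.
  (* The rows and columns indexed by the image of [h] form an identity block. *)
  have e : rowsub h (diag_mx v) *m colsub h 1%:M = 1%:M.
    apply/matrixP => i j; rewrite -mxsub_mul mulmx1 !mxE (inj_eq h_inj) v1.
    by [].
  rewrite -[r](mxrank1 F) -e; apply: leq_trans (mxrankM_maxl _ _) _.
  by rewrite rowsubE mxrankM_maxr.
rewrite (leq_trans le_m) // -addnA leq_add2l (leq_trans le_r) // D.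
apply: leq_trans (mxrank_add _ _) (leq_add _ _).
  exact: leq_trans (mxrankM_maxl _ _) (rank_leq_col _).
exact: leq_trans (mxrankM_maxl _ _) (rank_leq_col _).
Qed.

(** * Combinations of products of bounded weight *)

(** [phi] is a combination of products [f a x * f b y * f g z] of total weight at
    most [d].  The terms are listed over an arbitrary finite type [J] rather than
    over triples of indices in [B], so that sums and products of such expansions
    need no collecting of equal terms. *)
Definition weight_le (F : fieldType) (B : finType) (w : B -> nat) (d : nat)
    (X : Type) (f : B -> X -> F) (phi : X -> X -> X -> F) : Prop :=
  exists (J : finType) (c : J -> F) (al be ga : J -> B),
    (forall j, (w (al j) + w (be j) + w (ga j) <= d)%N) /\
    forall x y z, phi x y z = \sum_j c j * (f (al j) x * f (be j) y * f (ga j) z).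

Section WeightLe.
Variables (F : fieldType) (B : finType) (w : B -> nat) (d : nat) (X : Type)
  (f : B -> X -> F).

Lemma weight_le_ext (phi psi : X -> X -> X -> F) :
  (forall x y z, phi x y z = psi x y z) -> weight_le w d f phi -> weight_le w d f psi.
Proof.
move=> e [J [c [al [be [ga [le_d E]]]]]]; exists J, c, al, be, ga.
by split=> // x y z; rewrite -e.
Qed.

Lemma weight_le_term (c : F) (a b g : B) : (w a + w b + w g <= d)%N ->
  weight_le w d f (fun x y z => c * (f a x * f b y * f g z)).
Proof.
move=> le_d.
exists unit, (fun=> c), (fun=> a), (fun=> b), (fun=> g); split=> // x y z.
by rewrite (bigD1 tt) //= big1 ?addr0 // => -[].
Qed.

Lemma weight_leD phi psi : weight_le w d f phi -> weight_le w d f psi ->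
  weight_le w d f (fun x y z => phi x y z + psi x y z).
Proof.
move=> [J [c [al [be [ga [le_d E]]]]]] [J' [c' [al' [be' [ga' [le_d' E']]]]]].
pose or T (u : J -> T) (u' : J' -> T) t :=
  match t with inl j => u j | inr j => u' j end.
exists (J + J')%type, (or _ c c'), (or _ al al'), (or _ be be'), (or _ ga ga').
split=> [[]//|x y z]; rewrite E E' big_sumType /=.
by [].
Qed.

Lemma weight_leN phi : weight_le w d f phi ->
  weight_le w d f (fun x y z => - phi x y z).
Proof.
move=> [J [c [al [be [ga [le_d E]]]]]].
exists J, (fun j => - c j), al, be, ga; split=> // x y z.
by rewrite E -sumrN; apply: eq_bigr => j _; rewrite mulNr.
Qed.

(** A change of family that does not raise weights preserves the bound; [s] may
    identify indices whose functions coincide. *)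
Lemma weight_le_basis (B' : finType) (w' : B' -> nat) (f' : B' -> X -> F)
    (s : B -> B') phi :
  (forall b x, f b x = f' (s b) x) -> (forall b, w' (s b) <= w b)%N ->
  weight_le w d f phi -> weight_le w' d f' phi.
Proof.
move=> ff' ww' [J [c [al [be [ga [le_d E]]]]]].
exists J, c, (s \o al), (s \o be), (s \o ga); split=> [j|x y z] /=.
  by apply: leq_trans (le_d j); rewrite !leq_add.
by rewrite E; apply: eq_bigr => j _; rewrite !ff'.
Qed.

Lemma weight_le_scale phi (g : X -> F) : weight_le w d f phi ->
  weight_le w d (fun b x => g x * f b x)
    (fun x y z => g x * g y * g z * phi x y z).
Proof.
move=> [J [c [al [be [ga [le_d E]]]]]].
exists J, c, al, be, ga; split=> // x y z.
by rewrite E mulr_sumr; apply: eq_bigr => j _; ring.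
Qed.

(** Multiplying out.  The projections [p i] serve two purposes: the Frobenius
    powers [x^(3^l)] of a single field element, and the coordinates of a
    vector. *)
Lemma weight_le_prod phi (n : nat) (X' : Type) (p : 'I_n -> X' -> X) :
  weight_le w d f phi ->
  weight_le (fun a : {ffun 'I_n -> B} => \sum_i w (a i))%N (n * d)
    (fun a x => \prod_i f (a i) (p i x))
    (fun x y z => \prod_i phi (p i x) (p i y) (p i z)).
Proof.
move=> [J [c [al [be [ga [le_d E]]]]]].
exists {ffun 'I_n -> J}, (fun t : {ffun 'I_n -> J} => \prod_i c (t i)),
  (fun t : {ffun 'I_n -> J} => [ffun i => al (t i)]),
  (fun t : {ffun 'I_n -> J} => [ffun i => be (t i)]),
  (fun t : {ffun 'I_n -> J} => [ffun i => ga (t i)]); split=> [t|x y z].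
  rewrite -!big_split /= -[n in (n * d)%N]card_ord -sum_nat_const.
  by apply: leq_sum => i _; rewrite !ffunE.
under eq_bigr => i _ do rewrite E.
rewrite bigA_distr_bigA; apply: eq_bigr => t _.
by rewrite -!big_split; apply: eq_bigr => i _; rewrite !ffunE.
Qed.
End WeightLe.

Lemma weight_le_rescale (F : fieldType) (B : finType) (w : B -> nat) (d e : nat)
    (X : Type) (f : B -> X -> F) phi :
  weight_le w d f phi -> weight_le (fun b => e * w b)%N (e * d) f phi.
Proof.
move=> [J [c [al [be [ga [le_d E]]]]]]; exists J, c, al, be, ga; split=> // j.
by rewrite -!mulnDr leq_mul2l le_d orbT.
Qed.

(** A product of total weight at most [3 e] has a factor of weight at most [e].
    Grouping the terms by such a factor, in the first variable whenever possible,
    then in the second, then in the third, writes the diagonal tensor as a sum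
    of slices indexed by three copies of [S]. *)
Lemma weight_le_diagonal (F : fieldType) (B : finType) (w : B -> nat) (e : nat)
    (X : finType) (f : B -> X -> F) phi (A : {set X}) :
  weight_le w (3 * e) f phi ->
  {in A & A & A, forall x y z, phi x y z = ((x == y) && (y == z))%:R} ->
  (#|A| <= 3 * #|[set b | (w b <= e)%N]|)%N.
Proof.
move=> [J [c [al [be [ga [le_d E]]]]]] diag.
set S := [set b | _].
pose v (i : 'I_#|A|) := enum_val i.
have slice (P : pred J) (k : J -> B) (u : B -> F) (g : J -> F) :
    (forall j, P j -> k j \in S) ->
    \sum_(j | P j) u (k j) * g j
      = \sum_(a < #|S|) u (enum_val a) * \sum_(j | P j && (k j == enum_val a)) g j.
  move=> kS; rewrite (partition_big k (mem S)) //= big_enum_val /=.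
  apply: eq_bigr => a _; rewrite mulr_sumr.
  by apply: eq_bigr => j /andP[_ /eqP ->].
pose P1 j := al j \in S.
pose P2 j := ~~ P1 j && (be j \in S).
pose P3 j := ~~ P1 j && (be j \notin S).
have P3S j : P3 j -> ga j \in S.
  by move: (le_d j); rewrite /P3 /P1 !inE; lia.
rewrite mulSn mulSn mul1n addnA.
apply: (@slice_rank_diagonal F #|A| #|S| #|S| #|S|
  (fun a i => f (enum_val a) (v i))
  (fun a i j => \sum_(t | P1 t && (al t == enum_val a)) c t * f (be t) (v i) * f (ga t) (v j))
  (fun a i => f (enum_val a) (v i))
  (fun a i j => \sum_(t | P2 t && (be t == enum_val a)) c t * f (al t) (v i) * f (ga t) (v j))
  (fun a i => f (enum_val a) (v i))
  (fun a i j => \sum_(t | P3 t && (ga t == enum_val a)) c t * f (al t) (v i) * f (be t) (v j))).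
move=> x y z.
rewrite -(inj_eq enum_val_inj x y) -(inj_eq enum_val_inj y z).
rewrite -diag ?enum_valP // E.
rewrite -(slice P1 al (f^~ (v x)) (fun t => c t * f (be t) (v y) * f (ga t) (v z))) //.
rewrite -(slice P2 be (f^~ (v y)) (fun t => c t * f (al t) (v x) * f (ga t) (v z)));
  last by move=> j /andP[].
rewrite -(slice P3 ga (f^~ (v z)) (fun t => c t * f (al t) (v x) * f (be t) (v y))) //.
rewrite (bigID P1) /= -addrA /P2 /P3; congr (_ + _).
  by apply: eq_bigr => j _; rewrite /v; ring.
rewrite (bigID (fun j => be j \in S)) /=; congr (_ + _);
  by apply: eq_bigr => j _; rewrite /v; ring.
Qed.

(** * The indicator of e2 = 0 in one coordinate *)

Lemma weight_le_sum_squared (F : fieldType) :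
  weight_le (fun b : 'I_3 => b : nat) 2 (fun b (x : F) => x ^+ b)
    (fun x y z => (x + y + z) ^+ 2).
Proof.
pose i0 : 'I_3 := ord0; pose i1 : 'I_3 := inord 1; pose i2 : 'I_3 := ord_max.
have v1 : i1 = 1%N :> nat by rewrite inordK.
have t (c : F) (a b g : 'I_3) := @weight_le_term F 'I_3 (fun b => b) 2 F (fun b x => x ^+ b) c a b g.
apply: weight_le_ext (weight_leD (weight_leD (weight_leD (weight_leD (weight_leD
  (t 1 i2 i0 i0 _) (t 1 i0 i2 i0 _)) (t 1 i0 i0 i2 _)) (t 2 i1 i1 i0 _))
  (t 2 i1 i0 i1 _)) (t 2 i0 i1 i1 _)); rewrite /= ?v1 //.
by move=> x y z; ring.
Qed.

Section OneCoordinate.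
Variables (F : finFieldType) (k : nat).
Hypotheses (hF : #|F| = (3 ^ k)%N) (k_gt0 : (0 < k)%N).

Definition exponents := {ffun 'I_k -> 'I_3}.
Definition top_exponents : exponents := [ffun=> ord_max].
Definition degree (a : exponents) : nat := (\sum_l a l)%N.

(** Since [0^-1 = 0], the value at [x = 0] is 0 or 1 according to the exponents;
    [inv_basis] masks it. *)
Definition inv_monomial (a : exponents) (x : F) : F :=
  \prod_(l < k) (x^-1 ^+ (3 ^ l)) ^+ a l.

(** The monomials in the Frobenius powers of [x^-1], restricted to nonzero [x],
    except that the top one, which would duplicate the constant, makes room for
    the indicator of zero. *)
Definition inv_basis (a : exponents) (x : F) : F :=
  if a == top_exponents then (x == 0)%:R else (x != 0)%:R * inv_monomial a x.

(** Three times the degree, and [2k] for the indicator of zero: the cube of that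
    indicator then has weight exactly [6k]. *)
Definition basis_weight (a : exponents) : nat :=
  if a == top_exponents then (2 * k)%N else (3 * degree a)%N.

Lemma char3 : 3%N \in [pchar F].
Proof. exact: card_finPcharP hF isT. Qed.

Lemma three_eq0 : 3 = 0 :> F.
Proof. by have /andP[_ /eqP] := char3. Qed.

(** All base 3 digits of [q - 1] are equal to 2. *)
Lemma card_pred_sum : #|F|.-1 = (\sum_(l < k) 3 ^ l * 2)%N.
Proof. by rewrite hF predn_exp -big_distrl /= mulnC. Qed.

Lemma expf_card_pred (x : F) : x != 0 -> x ^+ #|F|.-1 = 1.
Proof.
move=> x0; apply: (mulfI x0); rewrite mulr1 -exprS prednK ?expf_card //.
by rewrite hF expn_gt0.
Qed.

Lemma exp_card_sum (u v w : F) : (u + v + w) ^+ #|F|.-1 =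
  \prod_(l < k) (u ^+ (3 ^ l) + v ^+ (3 ^ l) + w ^+ (3 ^ l)) ^+ 2.
Proof.
rewrite card_pred_sum -prodrXr; apply: eq_bigr => l _.
have c3 : [pchar F].-nat (3 ^ l)%N.
  by rewrite pnatX pnatE // (char3) ?orbT.
by rewrite exprM (exprDn_pchar _ _ c3) (exprDn_pchar _ _ c3).
Qed.

Lemma degree_top : degree top_exponents = (2 * k)%N.
Proof.
rewrite /degree; under eq_bigr => l _ do rewrite ffunE /=.
by rewrite sum_nat_const card_ord mulnC.
Qed.

Lemma zero_neq_top : ([ffun=> ord0] == top_exponents :> exponents) = false.
Proof. by apply/eqP => /ffunP/(_ (Ordinal k_gt0)); rewrite !ffunE. Qed.

Lemma degree0 : degree [ffun=> ord0] = 0%N.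
Proof. by rewrite /degree big1 // => l _; rewrite ffunE. Qed.

Lemma inv_monomial0 x : inv_monomial [ffun=> ord0] x = 1.
Proof. by rewrite /inv_monomial big1 // => l _; rewrite ffunE. Qed.

Lemma inv_monomial_top x : x != 0 -> inv_monomial top_exponents x = 1.
Proof.
move=> x0; have := expf_card_pred (invr_neq0 x0).
rewrite card_pred_sum -prodrXr => e; rewrite -[RHS]e /inv_monomial.
by apply: eq_bigr => l _; rewrite ffunE exprM.
Qed.

Lemma basis0 x : inv_basis [ffun=> ord0] x = (x != 0)%:R.
Proof. by rewrite /inv_basis zero_neq_top inv_monomial0 mulr1. Qed.

Lemma e2_inv (x y z : F) : x != 0 -> y != 0 -> z != 0 ->
  (e2 x y z == 0) = (x^-1 + y^-1 + z^-1 == 0).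
Proof.
move=> x0 y0 z0; have -> : e2 x y z = x * y * z * (x^-1 + y^-1 + z^-1).
  by rewrite /e2; field; rewrite x0 y0 z0.
by rewrite !mulf_eq0 (negPf x0) (negPf y0) (negPf z0).
Qed.

Lemma e2_indicator (x y z : F) : (e2 x y z == 0)%:R =
  (x != 0)%:R * (y != 0)%:R * (z != 0)%:R
  - (x != 0)%:R * (y != 0)%:R * (z != 0)%:R * (x^-1 + y^-1 + z^-1) ^+ #|F|.-1
  + (x == 0)%:R * (y == 0)%:R * (z != 0)%:R
  + (x == 0)%:R * (y != 0)%:R * (z == 0)%:R
  + (x != 0)%:R * (y == 0)%:R * (z == 0)%:R
  + (x == 0)%:R * (y == 0)%:R * (z == 0)%:R :> F.
Proof.
have [-> | x0] := eqVneq x 0; have [-> | y0] := eqVneq y 0;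
  have [-> | z0] := eqVneq z 0;
  rewrite /= ?(mul0r, mulr0, mul1r, mulr1, add0r, addr0, subr0, oppr0);
  try by rewrite /e2 ?(mul0r, mulr0, add0r, addr0) ?eqxx // mulf_eq0
    ?(negPf x0) ?(negPf y0) ?(negPf z0).
rewrite e2_inv //; have [-> | s0] := eqVneq (_ + _ + _) 0.
  have /negPf q1 : #|F|.-1 != 0%N.
    by rewrite hF -(prednK k_gt0) expnS; have := expn_gt0 3 k.-1; lia.
  by rewrite expr0n q1 subr0.
by rewrite expf_card_pred // subrr.
Qed.

(** The products of indicators have weight 0, [4k] or [6k].  The power of the sum
    of inverses has degree [2k] in the monomials, hence weight [6k]; replacing
    the top monomial by the constant only lowers it. *)
Lemma e2_weight_le :
  weight_le basis_weight (3 * (2 * k)) inv_basis (fun x y z => (e2 x y z == 0)%:R).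
Proof.
have t c a b g := @weight_le_term F exponents basis_weight (3 * (2 * k)) F inv_basis c a b g.
pose o : exponents := [ffun=> ord0].
have wo : basis_weight o = 0%N by rewrite /basis_weight zero_neq_top degree0.
have wt : basis_weight top_exponents = (2 * k)%N by rewrite /basis_weight eqxx.
have main : weight_le basis_weight (3 * (2 * k)) inv_basis (fun x y z =>
    (x != 0)%:R * (y != 0)%:R * (z != 0)%:R * (x^-1 + y^-1 + z^-1) ^+ #|F|.-1).
  have := weight_le_prod (fun l x => x^-1 ^+ (3 ^ (l : 'I_k))) (weight_le_sum_squared F).
  move/(weight_le_scale (fun x => (x != 0)%:R)).
  move/(weight_le_rescale 3); rewrite mulnC [(k * 2)%N]mulnC mulnC.
  move/(weight_le_basis (w' := basis_weight) (f' := inv_basis)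
    (s := fun a => if a == top_exponents then o else a)) => W.
  apply: weight_le_ext (W _ _).
  - by move=> x y z /=; rewrite exp_card_sum.
  - move=> a x; case: ifP => [/eqP ->|a_top].
      rewrite basis0; have [->|x0] := eqVneq x 0; first by rewrite mul0r.
      by rewrite -[X in _ * X]/(inv_monomial top_exponents x) inv_monomial_top // mulr1.
    by rewrite /inv_basis a_top.
  - move=> a; case: ifP => [_|a_top]; first by rewrite wo.
    by rewrite /basis_weight a_top.
apply: weight_le_ext (weight_leD (weight_leD (weight_leD (weight_leD (weight_leD
  (t 1 o o o _) (weight_leN main)) (t 1 top_exponents top_exponents o _)) (t 1 top_exponents o top_exponents _))
  (t 1 o top_exponents top_exponents _)) (t 1 top_exponents top_exponents top_exponents _)); rewrite ?wo ?wt; try lia.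
move=> x y z; rewrite e2_indicator !basis0 /inv_basis eqxx.
by rewrite !mul1r.
Qed.

End OneCoordinate.

(** * Sequences of vectors without a zero of e2 *)

(** The index functions of weight at most a third of [6kn]. *)
Definition light (k n : nat) : {set {ffun 'I_n -> exponents k}} :=
  [set a : {ffun 'I_n -> exponents k} | (\sum_i basis_weight (a i) <= n * (2 * k))%N].

Definition supp_size (F : finFieldType) (n : nat) (x : 'rV[F]_n) : nat :=
  #|[set i | x 0 i != 0]|.

Definition e2_vanish (F : finFieldType) (n : nat) (x y z : 'rV[F]_n) : bool :=
  [forall i, e2 (x 0 i) (y 0 i) (z 0 i) == 0].

Section Sequences.
Variables (F : finFieldType) (k : nat).
Hypotheses (hF : #|F| = (3 ^ k)%N) (k_gt0 : (0 < k)%N).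
Variable n : nat.
Implicit Types (x y z : 'rV[F]_n).

Lemma e2_vanish_weight_le : weight_le
  (fun a : {ffun 'I_n -> exponents k} => \sum_i basis_weight (a i))%N
  (3 * (n * (2 * k))) (fun a x => \prod_i inv_basis (a i) (x 0 i))
  (fun x y z => (e2_vanish x y z)%:R).
Proof.
have := weight_le_prod (fun (i : 'I_n) (x : 'rV[F]_n) => x 0 i) (e2_weight_le hF k_gt0).
rewrite mulnCA; apply: weight_le_ext => x y z.
rewrite /e2_vanish; case: forallP => [z0|nz].
  by rewrite big1 // => i _; rewrite z0.
have /forallPn[i zi] : ~~ [forall i, e2 (x 0 i) (y 0 i) (z 0 i) == 0] by apply/forallP.
by rewrite (bigD1 i) //= (negPf zi) mul0r.
Qed.

Lemma card_diagonal_e2 (A : {set 'rV[F]_n}) :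
  {in A & A & A, forall x y z, e2_vanish x y z = (x == y) && (y == z)} ->
  (#|A| <= 3 * #|light k n|)%N.
Proof.
move=> diag; apply: (weight_le_diagonal e2_vanish_weight_le) => x y z xA yA zA.
by rewrite /= diag.
Qed.

Lemma e2_vanish_diag x : e2_vanish x x x.
Proof.
apply/forallP => i; apply/eqP; rewrite /e2 -mulr2n -mulrSr -mulr_natl.
by rewrite (three_eq0 hF) mul0r.
Qed.

Lemma e2_swap (a b c : F) : e2 a b c = e2 b a c.
Proof. by rewrite /e2; ring. Qed.

Lemma e2_rot (a b c : F) : e2 a b c = e2 b c a.
Proof. by rewrite /e2; ring. Qed.

Lemma e2_vanish_swap x y z : e2_vanish x y z = e2_vanish y x z.
Proof. by apply: eq_forallb => i; rewrite e2_swap. Qed.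

Lemma e2_vanish_rot x y z : e2_vanish x y z = e2_vanish y z x.
Proof. by apply: eq_forallb => i; rewrite e2_rot. Qed.

(** In characteristic 3, [e2 a a b = a (a - b)]: each coordinate of [x] is zero
    or that of [y], and equal support sizes exclude the former where [y] is
    nonzero. *)
Lemma e2_vanish_double x y :
  e2_vanish x x y -> supp_size x = supp_size y -> x = y.
Proof.
move=> /forallP e card_eq.
have xy i : x 0 i = 0 \/ x 0 i = y 0 i.
  have /eqP : x 0 i * (x 0 i - y 0 i) = 0.
    have := three_eq0 hF; have /eqP := e i; rewrite /e2 => h h3.
    transitivity (x 0 i * x 0 i + x 0 i * y 0 i + y 0 i * x 0 i - 3 * (x 0 i * y 0 i)).
      by ring.
    by rewrite h h3 mul0r subr0.
  by rewrite mulf_eq0 subr_eq0 => /orP[] /eqP; [left | right].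
have /eqP/setP sub : [set i | x 0 i != 0] == [set i | y 0 i != 0].
  rewrite eqEcard -[#|_|]/(supp_size y) -card_eq leqnn andbT.
  apply/fintype.subsetP => i; rewrite !inE.
  by case: (xy i) => ->; rewrite ?eqxx.
apply/rowP => i; case: (xy i) => // xi0; rewrite xi0.
by have := sub i; rewrite !inE xi0 eqxx => /esym/negbFE/eqP.
Qed.

(** The three vectors occur in [s] in some order, and [e2] is symmetric. *)
Lemma e2_vanish_subseq (s : seq 'rV[F]_n) x y z :
  x \in s -> y \in s -> z \in s -> uniq [:: x; y; z] -> e2_vanish x y z ->
  has_e2_zero s.
Proof.
move=> xs ys zs u e.
set t := undup [seq a <- s | a \in [:: x; y; z]].
have ts : subseq t s := subseq_trans (undup_subseq _) (filter_subseq _ _).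
have tP : perm_eq t [:: x; y; z].
  apply: uniq_perm; rewrite ?undup_uniq // => a.
  rewrite mem_undup mem_filter andb_idr // !inE.
  by move=> /or3P[] /eqP->.
have ut : uniq t := undup_uniq _.
have : all (mem [:: x; y; z]) t by apply/allP => a; rewrite (perm_mem tP).
have tsize : size t = 3 := perm_size tP.
clearbody t; case: t tsize ts ut {tP} => [|a [|b [|c [|]]]] //= _ ts ut abc.
exists a, b, c; split=> // i; apply/eqP; move: i; apply/forallP.
rewrite -[X in is_true X]/(e2_vanish a b c).
move: ut abc; rewrite !inE !andbT => ut /and3P[].
have [exyz eyxz] := (e, e); rewrite e2_vanish_swap in eyxz.
by do 3 ![case/or3P=> /eqP ?]; subst; move: ut; rewrite ?eqxx ?orbT //= ?andbF // => _;
  first [done | by rewrite e2_vanish_rot | by do 2 rewrite e2_vanish_rot].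
Qed.

(** A vector occurring three times would be a solution, as
    [e2 a a a = 3 a^2 = 0]. *)
Lemma size_le_card (s : seq 'rV[F]_n) :
  ~ has_e2_zero s -> (size s <= 2 * #|[set x in s]|)%N.
Proof.
move=> nz.
have -> : size s = (\sum_x count_mem x s)%N.
  elim: s {nz} => [|a s IH] /=; first by rewrite big1.
  rewrite big_split /= -IH (bigD1 a) //= eqxx big1 ?addn0 // => i.
  by rewrite eq_sym => /negPf ->.
rewrite mulnC -sum_nat_const [leqRHS]big_mkcond /=; apply: leq_sum => x _.
rewrite inE; case: ifP => [xs|/negbT xs]; last by rewrite (count_memPn xs).
rewrite leqNgt; apply/negP => c; apply: nz; exists x, x, x; split; last first.
  by move=> i; apply/eqP; have /forallP := e2_vanish_diag x.
apply: subseq_trans (filter_subseq (pred1 x) s).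
have /all_pred1P -> := filter_all (pred1 x) s.
by rewrite size_filter; case: count c => [|[|[|c]]] //= _; rewrite !eqxx sub0seq.
Qed.

(** Three distinct members would be a solution in [s]; two distinct ones, one of
    them repeated, are excluded by [e2_vanish_double] as the support sizes
    agree. *)
Lemma card_support_class (s : seq 'rV[F]_n) (j : nat) : ~ has_e2_zero s ->
  (#|[set x in s | supp_size x == j]| <= 3 * #|light k n|)%N.
Proof.
move=> nz; apply: card_diagonal_e2 => x y z.
rewrite !inE => /andP[xs /eqP xj] /andP[ys /eqP yj] /andP[zs /eqP zj].
apply/idP/andP => [e|[/eqP <- /eqP <-]]; last exact: e2_vanish_diag.
have [xy|xy] := eqVneq x y.
  subst y; split=> //; apply/eqP; apply: e2_vanish_double e _.
  by rewrite xj zj.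
have [yz|yz] := eqVneq y z.
  subst z; case/eqP: xy; apply/esym; apply: e2_vanish_double; last by rewrite xj yj.
  by rewrite e2_vanish_rot e2_vanish_rot.
have [xz|xz] := eqVneq x z.
  subst z; case/eqP: xy; apply: e2_vanish_double; last by rewrite xj yj.
  by rewrite e2_vanish_rot.
case: nz; apply: (e2_vanish_subseq xs ys zs) => //=.
by rewrite !inE negb_or xy yz xz.
Qed.

Lemma size_le_light (s : seq 'rV[F]_n) : ~ has_e2_zero s ->
  (size s <= 6 * n.+1 * #|light k n|)%N.
Proof.
move=> nz; apply: leq_trans (size_le_card nz) _.
have -> : #|[set x in s]| = (\sum_(j < n.+1) #|[set x in s | supp_size x == j]|)%N.
  have lt_supp x : (supp_size x < n.+1)%N.
    by rewrite ltnS -[X in (_ <= X)%N]card_ord max_card.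
  rewrite -sum1_card (partition_big (fun x => Ordinal (lt_supp x)) xpredT) //=.
  by apply: eq_bigr => j _; rewrite -sum1_card; apply: eq_bigl => x; rewrite !inE.
have : (\sum_(j < n.+1) #|[set x in s | supp_size x == j]|
    <= \sum_(j < n.+1) 3 * #|light k n|)%N.
  by apply: leq_sum => j _; apply: card_support_class.
by rewrite sum_nat_const card_ord; nia.
Qed.

Lemma EGZ_le_light : (EGZ hF n <= (6 * n.+1 * #|light k n|).+1)%N.
Proof.
rewrite /EGZ; case: ex_minnP => l _; apply; apply/asboolP => s s_big.
by case: (pselect (has_e2_zero s)) => // /size_le_light; rewrite leqNgt s_big.
Qed.

End Sequences.

(** * The number of light index functions and the constant C_k *)

(** Markov's inequality for the exponential moment: each counted [a] contributes
    at least 1 to the sum of [y^(n d - weight of a)], which factors over the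
    coordinates. *)
Lemma card_weight_le (R : realFieldType) (B : finType) (w : B -> nat) (n d : nat) (y : R) :
  1 <= y ->
  #|[set a : {ffun 'I_n -> B} | (\sum_i w (a i) <= n * d)%N]|%:R
    <= (y ^+ d * \sum_b y ^- w b) ^+ n.
Proof.
move=> y1; have y0 : 0 < y := lt_le_trans ltr01 y1.
have -> : (y ^+ d * \sum_b y ^- w b) ^+ n
    = \sum_(a : {ffun 'I_n -> B}) y ^+ (n * d) / y ^+ (\sum_i w (a i)).
  rewrite exprMn -exprM mulnC -mulr_sumr; congr (_ * _).
  rewrite -[n in LHS]card_ord -prodr_const bigA_distr_bigA.
  by apply: eq_bigr => a _; rewrite prodfV prodrXr.
rewrite -sum1_card natr_sum big_mkcond /=; apply: ler_sum => a _.
rewrite inE; case: ifP => [le_w|_]; last by rewrite divr_ge0 // exprn_ge0 // ltW.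
by rewrite ler_pdivlMr ?exprn_gt0 // mul1r ler_weXn2l.
Qed.

(** With [y^3 = x] the right-hand side is the function minimised in the
    definition of [C_k].  The summand 1 is the indicator of zero, of weight [2k];
    the other monomials give the power of the trinomial with its top term
    [y^(-6k)] removed. *)
Lemma sum_basis_weight (R : realFieldType) (k : nat) (y : R) : 0 < y ->
  y ^+ (2 * k) * (\sum_(a : exponents k) y ^- basis_weight a)
  = 1 + y ^- (4 * k) * ((1 + y ^+ 3 + (y ^+ 3) ^+ 2) ^+ k - 1).
Proof.
move=> y0; have yn0 : y != 0 by rewrite gt_eqF.
have E : \sum_(a : exponents k) y ^- (3 * degree a)
    = (1 + y ^- 3 + y ^- 6) ^+ k.
  rewrite -[k in RHS]card_ord -prodr_const.
  have -> : 1 + y ^- 3 + y ^- 6 = \sum_(b < 3) y ^- (3 * b).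
    by rewrite !big_ord_recr big_ord0 /= add0r muln0 expr0 invr1.
  rewrite bigA_distr_bigA; apply: eq_bigr => a _.
  by rewrite prodfV prodrXr /degree big_distrr.
rewrite (bigD1 (top_exponents k)) //=.
have -> : \sum_(a | a != top_exponents k) y ^- basis_weight a
   = (1 + y ^- 3 + y ^- 6) ^+ k - y ^- (6 * k).
  rewrite -E [X in _ = X - _](bigD1 (top_exponents k)) //= degree_top.
  rewrite (_ : 3 * (2 * k) = 6 * k)%N; last lia.
  rewrite addrAC subrr add0r.
  by apply: eq_bigr => a /negPf a_top; rewrite /basis_weight a_top.
rewrite {1}/basis_weight eqxx mulrDr mulfV ?expf_neq0 //; congr (_ + _).
have -> : 1 + y ^+ 3 + (y ^+ 3) ^+ 2 = y ^+ 6 * (1 + y ^- 3 + y ^- 6).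
  by field.
rewrite exprMn -!exprM.
have -> : (2 * k)%N = (k + k)%N by lia.
have -> : (4 * k)%N = (k + k + k + k)%N by lia.
have -> : (6 * k)%N = (k + k + k + k + k + k)%N by lia.
rewrite !exprD; have : y ^+ k != 0 by rewrite expf_neq0.
by move=> h; field.
Qed.

(** The function whose infimum over [x >= 1] is [C_k]. *)
Definition growth (R : realType) (k : nat) (x : R) : R :=
  1 + x `^ (- (4 * k%:R / 3)) * ((1 + x + x ^+ 2) ^+ k - 1).

Section Growth.
Variables (R : realType) (k : nat).
Implicit Types x c : R.

Lemma growth_cube (y : R) : 0 < y -> growth k (y ^+ 3) =
  1 + y ^- (4 * k) * ((1 + y ^+ 3 + (y ^+ 3) ^+ 2) ^+ k - 1).
Proof.
move=> y0; rewrite /growth; congr (1 + _ * _).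
rewrite -[y ^+ 3]powR_mulrn ?ltW // -powRrM.
have -> : 3%:R * - (4 * k%:R / 3) = - (4 * k)%:R :> R.
  by rewrite natrM; field.
by rewrite powRN powR_mulrn // ltW.
Qed.

Lemma cube_root x : 1 <= x -> exists2 y, 1 <= y & y ^+ 3 = x.
Proof.
move=> x1; exists (x `^ 3^-1).
  have e : 1 `^ 3^-1 = 1 :> R by rewrite powR1.
  by rewrite -[leLHS]e ge0_ler_powR ?nnegrE //; lra.
rewrite -powR_mulrn ?powR_ge0 // -powRrM mulVf ?pnatr_eq0 // powRr1 //; lra.
Qed.

(** For [x = y^3], the trinomial power minus 1 is at least [y^(6k)], hence at
    least [y^(4k)]. *)
Lemma growth_ge2 x : (0 < k)%N -> 1 <= x -> 2 <= growth k x.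
Proof.
move=> k0 /cube_root[y y1 <-]; have y0 : 0 < y by lra.
rewrite growth_cube // -[2]/(1 + 1) lerD2l mulrC ler_pdivlMr ?exprn_gt0 // mul1r.
rewrite lerBrDl.
have h : y ^+ (4 * k) <= (y ^+ 6) ^+ k.
  by rewrite -exprM ler_weXn2l //; lia.
have h2 : 1 + (y ^+ 6) ^+ k <= (1 + y ^+ 6) ^+ k.
  case: k k0 => // j _; rewrite [leRHS]exprS mulrDl mul1r exprS lerD //.
    by rewrite exprn_ege1 // lerDl exprn_ge0 // ltW.
  rewrite ler_pM2l ?exprn_gt0 //; rewrite lerXn2r ?nnegrE ?addr_ge0 ?exprn_ge0 ?ltW //.
  by rewrite ltrDr.
have h3 : (1 + y ^+ 6) ^+ k <= (1 + y ^+ 3 + (y ^+ 3) ^+ 2) ^+ k.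
  have y3 : 0 < y ^+ 3 by rewrite exprn_gt0.
  have y6 : y ^+ 6 = (y ^+ 3) ^+ 2 by rewrite -exprM.
  by apply: lerXn2r; rewrite ?nnegrE ?y6; nra.
lra.
Qed.

Lemma C_E : C_ R k = inf [set growth k x | x in [set x : R | 1 <= x]]%classic.
Proof. by []. Qed.

Lemma C_le_growth x : (0 < k)%N -> 1 <= x -> C_ R k <= growth k x.
Proof.
move=> k0 x1; rewrite C_E; apply: ge_inf; last by exists x.
by exists 2 => _ [u u1 <-]; apply: growth_ge2.
Qed.

Lemma C_greatest c : (forall x, 1 <= x -> c <= growth k x) -> c <= C_ R k.
Proof.
move=> h; rewrite C_E; apply: lb_le_inf; first by exists (growth k 1), 1 => /=.
by move=> _ [u u1 <-]; apply: h.
Qed.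

Lemma C_ge2 : (0 < k)%N -> 2 <= C_ R k.
Proof. by move=> k0; apply: C_greatest => x; apply: growth_ge2. Qed.

(** Taking [n]-th roots lets the infimum pass through the power, at fixed [n]. *)
Lemma C_pow_greatest (b : R) n : (0 < k)%N -> 0 <= b ->
  (forall x, 1 <= x -> b <= growth k x ^+ n) -> b <= C_ R k ^+ n.
Proof.
move=> k0 b0; case: n => [|n] h; first by have := h 1 (lexx _); rewrite !expr0.
have root c : 0 <= c -> (b <= c ^+ n.+1) = (b `^ n.+1%:R^-1 <= c).
  move=> c0; rewrite -{1}(powRr1 b0) -[X in b `^ X](mulVf (_ : n.+1%:R != 0)) ?pnatr_eq0 //.
  by rewrite powRrM powR_mulrn ?powR_ge0 // ler_pXn2r ?nnegrE ?powR_ge0.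
rewrite root; last by have := C_ge2 k0; lra.
by apply: C_greatest => x x1; rewrite -root ?h //; have := growth_ge2 k0 x1; lra.
Qed.

(** At [x = y^3 = (6/5)^3] the value is less than [1 + g^k] with
    [g = (1 + y^3 + y^6) / y^4].  Here [g^2 <= 8] and [g <= 3], so that
    [1 + g^k <= 1 + 8 * 3^(k-2) <= 9 * 3^(k-2)]. *)
Lemma C_lt : (1 < k)%N -> C_ R k < (3 ^ k)%:R.
Proof.
move=> k1; have [y yE] : exists y : R, y = 6 / 5 by exists (6 / 5).
have y0 : 0 < y by lra.
have y1 : 1 <= y ^+ 3 by rewrite yE; lra.
apply: le_lt_trans (C_le_growth _ y1) _; first by lia.
rewrite growth_cube //.
pose g : R := (1 + y ^+ 3 + (y ^+ 3) ^+ 2) / y ^+ 4.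
have -> : 1 + y ^- (4 * k) * ((1 + y ^+ 3 + (y ^+ 3) ^+ 2) ^+ k - 1)
   = 1 + g ^+ k - y ^- (4 * k).
  by rewrite /g expr_div_n -(exprM y 4) mulrBr mulr1 addrA [_^-1 * _]mulrC.
have : 0 < y ^- (4 * k) by rewrite invr_gt0 exprn_gt0.
have g0 : 0 <= g by rewrite /g yE; lra.
have g2 : g ^+ 2 <= 8 by rewrite /g yE; lra.
have g3 : g <= 3 by rewrite /g yE; lra.
have [j ->] : exists j, k = j.+2 by exists k.-2; lia.
have : g ^+ j <= 3 ^+ j by rewrite lerXn2r ?nnegrE.
have : 1 <= (3 : R) ^+ j by rewrite exprn_ege1 //; lra.
have : 0 <= g ^+ j by rewrite exprn_ge0.
rewrite natrX -[j.+2]addn2 !exprD.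
nra.
Qed.

Lemma growth_x0 : growth k (x0 R) = 1 + gamma R ^+ k - x0 R `^ (- (4 * k%:R / 3)).
Proof.
rewrite /growth /gamma (exprMn k) -[(_ `^ _) ^+ k]powR_mulrn ?powR_ge0 // -powRrM.
have -> : - (4 / 3) * k%:R = - (4 * k%:R / 3) :> R by field.
ring.
Qed.

Lemma x0_ge1 : 1 <= x0 R.
Proof.
rewrite /x0 ler_pdivlMr ?ltr0n // mul1r -lerBlDl.
have -> : 4 - 1 = Num.sqrt 9 :> R.
  by rewrite (_ : 9 = 3 ^+ 2) ?sqrtr_sqr ?ger0_norm //; lra.
by rewrite ler_sqrt; lra.
Qed.

End Growth.

(** * Asymptotics *)

Lemma EGZ_le_C (R : realType) (F : finFieldType) (k n : nat)
    (hF : #|F| = (3 ^ k)%N) : (0 < k)%N ->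
  (EGZ hF n)%:R <= (6 * n.+1)%:R * C_ R k ^+ n + 1.
Proof.
move=> k0; have le_light := EGZ_le_light hF k0 n.
have : #|light k n|%:R <= C_ R k ^+ n.
  apply: C_pow_greatest => // x /cube_root[y y1 <-].
  apply: le_trans (card_weight_le _ _ _ y1) _.
  by rewrite sum_basis_weight ?growth_cube //; lra.
rewrite -(ler_pM2l (_ : 0 < (6 * n.+1)%:R)) ?ltr0n // => h.
apply: le_trans (lerD h (lexx 1)).
by rewrite -natrM natr1 ler_nat.
Qed.

(** From [ln s < s] at [s = sqrt m] comes [ln m <= 2 sqrt m], which is of order
    [sqrt n] for [m = 6 n + 7]. *)
Lemma ln_linear_littleo (R : realType) (c : R) : 1 < c ->
  ((fun n : nat => ln (6 * n.+1 + 1)%:R / ln c : R) =o_\oo (fun n : nat => n%:R : R))%classic.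
Proof.
move=> c1; have lc : 0 < ln c by rewrite ln_gt0.
apply/eqoP => e e0; near=> n.
have n1 : (1 <= n)%N by near: n; exists 1%N.
have n1R : 1 <= n%:R :> R by rewrite ler1n.
set m := (6 * n.+1 + 1)%:R.
have mE : m = 6 * n%:R + 7 :> R by rewrite /m natrD natrM -natr1; ring.
have m1 : 1 <= m by lra.
have q0 : 0 <= ln m / ln c by rewrite divr_ge0 ?(ltW lc) // ln_ge0.
rewrite (ger0_norm q0) (ger0_norm (ler0n R n)) ler_pdivrMr //.
have sm : 0 < Num.sqrt m by rewrite sqrtr_gt0; lra.
have -> : m = Num.sqrt m ^+ 2 by rewrite sqr_sqrtr //; lra.
rewrite lnXn // mulr2n.
have := ln_sublinear sm; set s := Num.sqrt m in sm *; set l := ln s => ls.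
set d := e * ln c.
have d0 : 0 < d by rewrite mulr_gt0.
(* [4 m = 24 n + 28 <= 52 n] as [n >= 1]. *)
have big : 52 / d ^+ 2 <= n%:R by near: n; exact: nbhs_infty_ger.
suff : 2 * s <= d * n%:R by rewrite /d; lra.
rewrite -(@ler_pXn2r _ 2) ?nnegrE ?mulr_ge0 ?ler0n ?(ltW sm) ?(ltW e0) ?(ltW lc) //.
rewrite (exprMn 2 2 s) (exprMn 2 d) sqr_sqrtr; last lra.
move: big; rewrite ler_pdivrMr ?exprn_gt0 // => big.
have := ler_wpM2l (ler0n R n) big; rewrite mE; lra.
Unshelve. all: by end_near.
Qed.

(** The factor [6 n + 7 >= 6 (n + 1) + c ^- n] is absorbed into the exponent as
    its logarithm in base [c], which is [o(n)]. *)
Lemma le_exp_no_linear (R : realType) (E : nat -> nat) (c : R) : 1 < c ->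
  (forall n, (E n)%:R <= (6 * n.+1)%:R * c ^+ n + 1) -> le_exp_no E c.
Proof.
move=> c1 le_E; have c0 : 0 < c by lra.
exists (fun n => ln (6 * n.+1 + 1)%:R / ln c); first exact: ln_linear_littleo.
apply: nearW => n; apply: le_trans (le_E n) _.
rewrite powRD; last by rewrite (gt_eqF c0) implybT.
rewrite powR_mulrn ?(ltW c0) // [c `^ (_ / _)]/powR gt_eqF // divfK ?gt_eqF ?ln_gt0 //.
rewrite lnK ?posrE ?ltr0n ?addn1 // -natr1 mulrDr mulr1 mulrC lerD2l.
by rewrite exprn_ege1 // ltW.
Qed.

Theorem corollary3p7 (R : realType) (k : nat) (hk : (1 < k)%N)
    (F : finFieldType) (hF : #|F| = (3 ^ k)%N) :
  [/\ le_exp_no (EGZ hF) (C_ R k),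
      C_ R k < (3 ^ k)%:R
    & le_exp_no (EGZ hF)
        (1 + gamma R ^+ k - x0 R `^ (- (4 * k%:R / 3)))].
Proof.
have k0 : (0 < k)%N by lia.
have C2 := C_ge2 R k0.
split; [|exact: C_lt|].
  by apply: le_exp_no_linear => [|n]; [lra | exact: EGZ_le_C].
rewrite -growth_x0; have Cx0 := C_le_growth k0 (x0_ge1 R).
apply: le_exp_no_linear => [|n]; first lra.
apply: le_trans (EGZ_le_C R n hF k0) _.
rewrite lerD2r ler_wpM2l ?ler0n // lerXn2r ?nnegrE //; lra.
Qed.
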